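(* Suppose that $\theta>\theta_{\min}$. For every $d\in\mathbb R_+^N$ (finite entries), define $$\Phi(d)=\max\Big\{\mathbf 1^\top r-\epsilon\mathbf 1^\top w\ \Big|\ K_0+\bar\kappa^\top w+d^\top r\le\theta,\ \mathbf 1^\top w\ge\varepsilon,\ 0\le r\le w\le\tfrac1N\mathbf 1\Big\}$$ and $$\vartheta(d)=\min_{(w,r)\in\mathcal C_{\varepsilon,\epsilon}}\{K_0+\bar\kappa^\top w+d^\top r\}.$$ Then $$\Phi(d)\le0\iff\vartheta(d)\ge\theta.$$ Thus, a decision $z\in\mathcal Z$ satisfies the robust conditional chance constraint $\sup_{\mathbb P\in\mathcal P_{\theta,\varepsilon}(\mathcal N)}\mathbb P[Y\notin\mathcal S(z)\mid X\in\mathcal N]\le\epsilon$ if and only if $\vartheta(\Delta(z))\ge\theta$, where $\Delta(z)=(\Delta_i(z))_{i\in[N]}$.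
   Context: $[N]=\{1,\dots,N\}$; $\mathbf 1$ is the all-ones vector. Two distinct symbols are used: $\varepsilon\in(0,1]$ is a lower bound on the probability of the conditioning event, and $\epsilon\in(0,1)$ is the risk limit. $\mathcal X$ is the context space and $\mathcal Y$ the outcome space, with metrics $d_{\mathcal X},d_{\mathcal Y}$; $X,Y$ denote the two coordinates. $\mathcal Z\subseteq\mathbb R^{\dim(z)}$ is the decision set; $\mathcal S(z)\subseteq\mathcal Y$ is the safety set and $\mathcal S^c(z)=\mathcal Y\setminus\mathcal S(z)$. Given samples $(\hat x_i,\hat y_i)$, $i\in[N]$, let $\widehat{\mathbb P}_N=\frac1N\sum_i\delta_{(\hat x_i,\hat y_i)}$. $W$ is the type-1 Wasserstein distance with ground metric $d_{\mathcal X}(x,x')+d_{\mathcal Y}(y,y')$. $x_0\in\mathcal X$, $\gamma\ge0$, and $\mathcal N=\mathcal N_\gamma(x_0)\subseteq\mathcal X$ satisfies $x_0\in\mathcal N$, $\sup_{x\in\mathcal N}d_{\mathcal X}(x,x_0)\le\gamma$, $\mathcal N_0(x_0)=\{x_0\}$. With $\theta>0$ and $\mathbb P_X$ the $\mathcal X$-marginal, $\mathcal P_{\theta,\varepsilon}(\mathcal N)=\{\mathbb P: W(\mathbb P,\widehat{\mathbb P}_N)\le\theta,\ \mathbb P_X(\mathcal N)\ge\varepsilon\}$. Standing assumptions: (i) $(\mathcal X,d_{\mathcal X})$, $(\mathcal Y,d_{\mathcal Y})$ are Polish metric spaces with Borel $\sigma$-fields, transport allowed on all of $\mathcal X\times\mathcal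 Y$; (ii) $\mathcal N$ is Borel and the distances from each $\hat x_i$ to $\mathcal N$ and $\mathcal N^c$ are finite; (iii) for every $z\in\mathcal Z$, $\mathcal S^c(z)$ is a nonempty Borel set at finite distance from each $\hat y_i$. Define $\kappa_i^{\rm in}=\inf_{x\in\mathcal N}d_{\mathcal X}(\hat x_i,x)$, $\kappa_i^{\rm out}=\inf_{x\in\mathcal N^c}d_{\mathcal X}(\hat x_i,x)$, $\bar\kappa_i=\kappa_i^{\rm in}-\kappa_i^{\rm out}$, $K_0=\frac1N\sum_i\kappa_i^{\rm out}$, $\Delta_i(z)=\inf_{y\in\mathcal S^c(z)}d_{\mathcal Y}(\hat y_i,y)$, and $\theta_{\min}=\inf\{W(\mathbb P,\widehat{\mathbb P}_N):\mathbb P_X(\mathcal N)\ge\varepsilon\}$. The polytope of mass allocations at the conditional risk boundary is $$\mathcal C_{\varepsilon,\epsilon}=\Big\{(w,r)\in\mathbb R^{2N}: 0\le r\le w\le\tfrac1N\mathbf 1,\ \mathbf 1^\top w\ge\varepsilon,\ \mathbf 1^\top r=\epsilon\mathbf 1^\top w\Big\}.$$ *)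

(* Defs.v *)
From HB Require Import structures.
From mathcomp Require Import all_boot all_order all_algebra.
From mathcomp Require Import all_classical all_reals all_analysis.

Set Implicit Arguments.
Unset Strict Implicit.
Unset Printing Implicit Defensive.

Import Order.TTheory GRing.Theory Num.Theory.
Import numFieldNormedType.Exports.

Local Open Scope classical_set_scope.
Local Open Scope ring_scope.

(* The library only puts a sigma-algebra on pointed types; the chosen point
   plays no other role than witnessing nonemptiness. *)
#[short(type="completePMetricType")]
HB.structure Definition CompletePMetric (K : numDomainType) :=
  {M of Metric K M & Complete M & Pointed M}.

Definition separable (T : topologicalType) : Prop :=
  exists2 A : set T, countable A & dense A.

Notation borel T := (g_sigma_algebraType (@open T)).

Definition set_dist (R : realType) (T : completePMetricType R)
    (a : T) (A : set T) : \bar R :=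
  ereal_inf [set (mdist a x)%:E | x in A].

Definition ground_cost (R : realType) (X Y : completePMetricType R)
    (p q : X * Y) : R :=
  mdist p.1 q.1 + mdist p.2 q.2.

(* Measures are compared on measurable sets only: as functions on all sets,
   their values elsewhere are irrelevant. *)
Definition coupling (R : realType) (d : measure_display) (T : measurableType d)
    (P Q : {measure set T -> \bar R}) (pi : probability (T * T)%type R) : Prop :=
  forall A : set T, measurable A ->
    pushforward pi fst A = P A /\ pushforward pi snd A = Q A.

(* For separable X and Y the product of the two Borel sigma-algebras is the
   Borel sigma-algebra of the product space. *)
Definition wasserstein (R : realType) (X Y : completePMetricType R)
    (P Q : {measure set (borel X * borel Y)%type -> \bar R}) : \bar R :=
  ereal_inf [set (\int[pi]_u (@ground_cost R X Y u.1 u.2)%:E)%E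
            | pi in coupling P Q].

Definition empirical (R : realType) (d : measure_display)
    (T : measurableType d) (N : nat) (s : 'I_N -> T) (A : set T) : \bar R :=
  ((N%:R^-1)%:E * \sum_(i < N) \d_(s i) A)%E.
Arguments empirical R {d T N} s A.

Lemma empirical0 (R : realType) (d : measure_display) (T : measurableType d)
  (N : nat) (s : 'I_N -> T) : empirical R s set0 = 0%E.
Proof. by rewrite /empirical big1 ?mule0// => i _; exact: measure0. Qed.

Lemma empirical_ge0 (R : realType) (d : measure_display)
  (T : measurableType d) (N : nat) (s : 'I_N -> T) (A : set T) :
  (0 <= empirical R s A)%E.
Proof.
rewrite /empirical; apply: mule_ge0; first by rewrite lee_fin invr_ge0.
by apply: sume_ge0 => i _; exact: measure_ge0.
Qed.

Lemma empirical_sigma_additive (R : realType) (d : measure_display)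
  (T : measurableType d) (N : nat) (s : 'I_N -> T) :
  semi_sigma_additive (empirical R s).
Proof.
case: N s => [|n] s.
  have -> : empirical R s = mzero.
    by apply/funext => A; rewrite /empirical big_ord0 mule0.
  exact: measure_semi_sigma_additive.
have -> : empirical R s = mscale (n.+1%:R^-1)%:nng
    (msum (fun k => [the {measure set T -> \bar R} of \d_(s (inord k))]) n.+1).
  apply/funext => A; rewrite /empirical /mscale /msum /=.
  by congr (_ * _)%E; apply: eq_bigr => i _; rewrite inord_val.
exact: measure_semi_sigma_additive.
Qed.

HB.instance Definition _ (R : realType) (d : measure_display)
    (T : measurableType d) (N : nat) (s : 'I_N -> T) :=
  isMeasure.Build d T R (empirical R s)
    (empirical0 R s) (empirical_ge0 R s) (@empirical_sigma_additive R d T N s).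

Definition cond_prob (R : realType) (d : measure_display)
    (T : measurableType d) (P : probability T R) (A B : set T) : R :=
  fine (P (A `&` B)) / fine (P B).

Section ambiguity.
Context (R : realType) (X Y : completePMetricType R) (N : nat).
Variables (sample : 'I_N -> borel X * borel Y) (calN : set X) (eps : R).

Definition theta_min : \bar R :=
  ereal_inf [set wasserstein P (empirical R sample)
            | P in [set P : probability (borel X * borel Y)%type R
                   | (eps%:E <= pushforward P fst calN)%E]].

Definition ambiguity (theta : R) :
    set (probability (borel X * borel Y)%type R) :=
  [set P | (wasserstein P (empirical R sample) <= theta%:E)%E /\
           (eps%:E <= pushforward P fst calN)%E].

Definition robust_cond_chance (theta risk : R) (safe : set Y) : Prop :=
  (ereal_sup [set (cond_prob P (snd @^-1` (~` safe)) (fst @^-1` calN))%:E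
             | P in ambiguity theta] <= risk%:E)%E.

End ambiguity.

Section distances.
Context (R : realType) (X Y : completePMetricType R) (N : nat).
Variables (xhat : 'I_N -> X) (yhat : 'I_N -> Y) (calN : set X).

Definition kappa_in : 'rV[R]_N := \row_i fine (set_dist (xhat i) calN).

Definition kappa_out : 'rV[R]_N := \row_i fine (set_dist (xhat i) (~` calN)).

Definition kappa_bar : 'rV[R]_N := kappa_in - kappa_out.

Definition K0 : R := N%:R^-1 * \sum_i kappa_out 0 i.

Definition Delta (safe : set Y) : 'rV[R]_N :=
  \row_i fine (set_dist (yhat i) (~` safe)).

End distances.

Section linear_programs.
Context (R : realType) (N : nat).
Variables (k0 : R) (kbar : 'rV[R]_N) (theta eps risk : R).

Definition dotv (u v : 'rV[R]_N) : R := \sum_i u 0 i * v 0 i.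

Definition allocation (w r : 'rV[R]_N) : Prop :=
  forall i, 0 <= r 0 i <= w 0 i /\ w 0 i <= N%:R^-1.

Definition boundary_polytope : set ('rV[R]_N * 'rV[R]_N) :=
  [set u | [/\ allocation u.1 u.2, eps <= \sum_i u.1 0 i &
               \sum_i u.2 0 i = risk * \sum_i u.1 0 i]].

Definition transport_cost (d : 'rV[R]_N) (u : 'rV[R]_N * 'rV[R]_N) : R :=
  k0 + dotv kbar u.1 + dotv d u.2.

Definition Phi_values (d : 'rV[R]_N) : set R :=
  [set \sum_i u.2 0 i - risk * \sum_i u.1 0 i
  | u in [set u | [/\ transport_cost d u <= theta, eps <= \sum_i u.1 0 i &
                      allocation u.1 u.2]]].

(* [sup] and [inf] only name the two optimal values as total functions; that
   these are attained, i.e. are a maximum and a minimum, is asserted separately. *)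
Definition Phi (d : 'rV[R]_N) : R := sup (Phi_values d).

Definition vartheta_values (d : 'rV[R]_N) : set R :=
  transport_cost d @` boundary_polytope.

Definition vartheta (d : 'rV[R]_N) : R := inf (vartheta_values d).

End linear_programs.

(* Main.v *)
From HB Require Import structures.
Require Import Defs.
From mathcomp Require Import all_boot all_order all_algebra.
From mathcomp Require Import all_classical all_reals all_analysis.
From mathcomp Require Import measurable_realfun.
From mathcomp Require Import ring lra.

Set Implicit Arguments.
Unset Strict Implicit.
Unset Printing Implicit Defensive.

Import Order.TTheory GRing.Theory Num.Theory.
Import numFieldNormedType.Exports.

Local Open Scope classical_set_scope.
Local Open Scope ring_scope.

(** The bridge between the distributional problem and the linear programs is that
a coupling of [P] with the empirical measure can be summarized by a mass
allocation [(w, r)]: [w i] is the mass sent from sample [i] over the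
neighbourhood, [r i] the part of it with an unsafe outcome. The transport cost of
the coupling is at least the linear cost of its allocation
([coupling_allocation]), and each allocation is realized by a discrete
distribution with arbitrarily small extra cost ([allocation_coupling]). The
conditional risk exceeds the limit exactly when the excess
[mass r - risk * mass w] is positive.

On the linear side, [theta_min < theta] gives a strictly feasible allocation
[(w0, 0)], of nonpositive excess ([slater_allocation]). If some allocation has
positive excess within the budget [theta], the segment joining it to [(w0, 0)]
crosses the zero-excess boundary at a cost strictly below [theta]
([boundary_cost_lt]). Conversely a boundary allocation with budget to spare can
be pushed to positive excess, because the risk limit is below one
([boundary_to_excess]). Compactness of the set of allocations makes both optima
attained, which yields the equivalence for the linear programs ([Phi_le0E]).

The infimum over couplings defining the Wasserstein distance is only approached:
a distribution violating the chance constraint has couplings of cost at most [theta + delta] for every positive [delta], all with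
the same masses [mass w] and [mass r], and the crossing argument tolerates such
an error ([robust_cond_chanceP]). *)

(** * Linear programs over mass allocations *)

Section linear_programs.
Context (R : realType) (N : nat).
Implicit Types (d w r : 'rV[R]_N) (u v : 'rV[R]_N * 'rV[R]_N).

Definition mass w : R := \sum_i w 0 i.

Definition excess (risk : R) u : R := mass u.2 - risk * mass u.1.

Definition allocations (eps : R) : set ('rV[R]_N * 'rV[R]_N) :=
  [set u | eps <= mass u.1 /\ allocation u.1 u.2].

Lemma mass_lin a b w r : mass (a *: w + b *: r) = a * mass w + b * mass r.
Proof.
rewrite /mass !mulr_sumr -big_split; apply: eq_bigr => i _ /=.
by rewrite !mxE.
Qed.

Lemma dotv_lin d a b w r :
  dotv d (a *: w + b *: r) = a * dotv d w + b * dotv d r.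
Proof.
rewrite /dotv !mulr_sumr -big_split; apply: eq_bigr => i _ /=.
by rewrite !mxE; ring.
Qed.

Lemma excess_lin risk a b u v :
  excess risk (a *: u + b *: v) = a * excess risk u + b * excess risk v.
Proof. by rewrite /excess !mass_lin; ring. Qed.

Lemma transport_cost_conv k0 kbar d t u v :
  transport_cost k0 kbar d (t *: u + (1 - t) *: v) =
  t * transport_cost k0 kbar d u + (1 - t) * transport_cost k0 kbar d v.
Proof. by rewrite /transport_cost !dotv_lin; ring. Qed.

Lemma allocations_conv eps t u v : 0 <= t <= 1 ->
  allocations eps u -> allocations eps v ->
  allocations eps (t *: u + (1 - t) *: v).
Proof.
move=> /andP[t0 t1] [eu au] [ev av]; split; first by rewrite mass_lin; nra.
move=> i; rewrite !mxE.
by have [/andP[? ?] ?] := au i; have [/andP[? ?] ?] := av i;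
  split; [apply/andP; split|]; nra.
Qed.

Lemma boundary_polytopeE eps risk :
  boundary_polytope eps risk = allocations eps `&` [set u | excess risk u = 0].
Proof.
apply/seteqP; split => u.
  by case=> au eu ru; split => //=; rewrite /excess /mass ru subrr.
by case=> -[eu au] /eqP; rewrite subr_eq0 => /eqP.
Qed.

Lemma Phi_valuesE k0 kbar theta eps risk d :
  Phi_values k0 kbar theta eps risk d =
  excess risk @` (allocations eps `&` [set u | transport_cost k0 kbar d u <= theta]).
Proof.
apply/seteqP; split => x [u]; first by move=> [cu eu au] <-; exists u.
by move=> [[eu au] cu] <-; exists u.
Qed.

(** Near-optimal couplings only give allocations whose cost exceeds [theta] by an
arbitrarily small amount, while their excess [c] over the risk boundary is the
same for all of them. Mixing with the Slater allocation [(w0, 0)], whose excess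
is nonpositive and whose cost is strictly below [theta], lands exactly on the
boundary; the weight of the Slater point does not depend on [delta], so the cost it saves
eventually outweighs the error. *)
Lemma boundary_cost_lt k0 kbar d theta eps risk c w0 : 0 < risk -> 0 < c ->
  allocations eps (w0, 0) -> transport_cost k0 kbar d (w0, 0) < theta ->
  (forall delta, 0 < delta -> exists u, [/\ allocations eps u,
     transport_cost k0 kbar d u <= theta + delta & excess risk u = c]) ->
  exists2 v, boundary_polytope eps risk v & transport_cost k0 kbar d v < theta.
Proof.
move=> risk0 c0 a0 cost0 near.
have m0 : 0 <= mass w0.
  apply: sumr_ge0 => i _; have [_ /(_ i)[/andP[? ?] _]] := a0.
  by apply: le_trans; eauto.
pose e0 := risk * mass w0; have e00 : 0 <= e0 by rewrite mulr_ge0// ltW.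
have exc0 : excess risk (w0, 0) = - e0.
  by rewrite /excess /= [mass 0]big1 ?sub0r// => i _; rewrite mxE.
set x := transport_cost _ _ _ _ in cost0.
(* The weight for which the excess of the mixture, (1 - t) c - t e0, vanishes. *)
pose t := c / (c + e0).
have ce0 : 0 < c + e0 by lra.
have t0 : 0 < t by rewrite divr_gt0.
have t1 : t <= 1 by rewrite ler_pdivrMr//; lra.
have [|u [au cu eu]] := near (t * (theta - x) / 2).
  by rewrite divr_gt0// mulr_gt0// subr_gt0.
exists (t *: (w0, 0) + (1 - t) *: u).
  rewrite boundary_polytopeE; split.
    by apply: allocations_conv; rewrite ?t1 ?(ltW t0).
  by rewrite /= excess_lin exc0 eu /t; field; rewrite gt_eqF.
rewrite transport_cost_conv -/x; set y := transport_cost _ _ _ _ in cu *.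
have h : 0 < t * (theta - x) by rewrite mulr_gt0// subr_gt0.
have : (1 - t) * y <= (1 - t) * (theta + t * (theta - x) / 2).
  by rewrite ler_wpM2l// subr_ge0.
nra.
Qed.

(** With strict slack in the budget one can move a little towards [r = w]: since
[risk < 1] and the total mass is positive, this increases the excess strictly,
and a small enough step keeps the cost below [theta]. *)
Lemma boundary_to_excess k0 kbar d theta eps risk v : 0 < eps -> risk < 1 ->
  boundary_polytope eps risk v -> transport_cost k0 kbar d v < theta ->
  exists u, [/\ allocations eps u, transport_cost k0 kbar d u < theta &
                0 < excess risk u].
Proof.
move=> eps0 risk1; rewrite boundary_polytopeE => -[av ev] cv.
pose x : R := transport_cost k0 kbar d v.
pose y : R := transport_cost k0 kbar d (v.1, v.1).
have av1 : allocations eps (v.1, v.1).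
  case: av => ? av; split=> // i; have [/andP[? ?] ?] := av i.
  by split=> //=; rewrite lexx andbT; lra.
pose g := theta - x; have g0 : 0 < g by rewrite subr_gt0.
(* This step lies in (0, 1] and costs t (y - x) < g. *)
pose t := g / (g + `|y - x|).
have gy0 : 0 < g + `|y - x| by rewrite ltr_wpDr.
have t0 : 0 < t by rewrite divr_gt0.
have t1 : t <= 1 by rewrite ler_pdivrMr// mul1r lerDl.
exists (t *: (v.1, v.1) + (1 - t) *: v); split.
- by apply: allocations_conv; rewrite ?t1 ?(ltW t0).
- rewrite transport_cost_conv -/x -/y.
  have e : t * (g + `|y - x|) = g by rewrite /t divfK// gt_eqF.
  have := ler_norm (y - x); have : 0 < t * g by rewrite mulr_gt0.
  rewrite /g in e * => ? ?.
  have : t * (y - x) <= t * `|y - x| by rewrite ler_wpM2l// ltW.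
  nra.
- rewrite excess_lin ev mulr0 addr0 mulr_gt0// /excess /=.
  by case: av => mv _; nra.
Qed.

Lemma continuous_coord1 i : continuous (fun u : 'rV[R]_N * 'rV[R]_N => u.1 0 i).
Proof.
by move=> u; apply: (@continuous_comp _ _ _ fst (fun w : 'rV[R]_N => w 0 i));
  [exact: cvg_fst|exact: coord_continuous].
Qed.

Lemma continuous_coord2 i : continuous (fun u : 'rV[R]_N * 'rV[R]_N => u.2 0 i).
Proof.
by move=> u; apply: (@continuous_comp _ _ _ snd (fun w : 'rV[R]_N => w 0 i));
  [exact: cvg_snd|exact: coord_continuous].
Qed.


Lemma continuous_transport_cost k0 kbar d :
  continuous (transport_cost k0 kbar d).
Proof.
have c0 : continuous (fun u : 'rV[R]_N * 'rV[R]_N => \sum_i kbar 0 i * u.1 0 i).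
  apply: continuous_big => [|i _ u]; first exact: add_continuous.
  by apply: cvgM; [exact: cvg_cst|exact: continuous_coord1].
have c1 : continuous (fun u : 'rV[R]_N * 'rV[R]_N => \sum_i d 0 i * u.2 0 i).
  apply: continuous_big => [|i _ u]; first exact: add_continuous.
  by apply: cvgM; [exact: cvg_cst|exact: continuous_coord2].
move=> u; apply: cvgD; last exact: c1.
by apply: cvgD; [exact: cvg_cst|exact: c0].
Qed.

(** Total mass and excess are instances of [transport_cost], so that one continuity
lemma serves the budget, the mass constraint and the risk constraint. *)
Lemma mass1E u : mass u.1 = transport_cost 0 (const_mx 1) 0 u.
Proof.
rewrite /transport_cost add0r /dotv -big_split; apply: eq_bigr => i _ /=.
by rewrite !mxE; ring.
Qed.

Lemma excessE risk u :
  excess risk u = transport_cost 0 (const_mx (- risk)) (const_mx 1) u.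
Proof.
rewrite /transport_cost add0r /excess /dotv /mass mulr_sumr -sumrN addrC.
by congr (_ + _); apply: eq_bigr => i _; rewrite !mxE; ring.
Qed.

Lemma continuous_excess risk : continuous (excess risk).
Proof.
rewrite (_ : excess risk = transport_cost 0 (const_mx (- risk)) (const_mx 1)).
  exact: continuous_transport_cost.
by apply/funext => u; exact: excessE.
Qed.

Lemma allocations_compact eps : compact (allocations eps).
Proof.
pose box := [set w : 'rV[R]_N | forall i, `[0, N%:R^-1]%classic (w ord0 i)].
have cbox : compact box.
  by apply: (@rV_compact R N (fun=> `[0, N%:R^-1]%classic)) => i;
    exact: segment_compact.
have -> : allocations eps = (box `*` box) `&`
    ([set u : 'rV[R]_N * 'rV[R]_N | eps <= transport_cost 0 (const_mx 1) 0 u] `&`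
     \bigcap_(i in [set: 'I_N]) [set u : 'rV[R]_N * 'rV[R]_N | 0 <= u.1 0 i - u.2 0 i]).
  apply/seteqP; split => u.
    case=> eu au; split; last first.
      split; rewrite /= -?mass1E// => i _ /=.
      by have [/andP[_ ?] _] := au i; rewrite subr_ge0.
    by split=> i /=; rewrite in_itv/=; have [/andP[? ?] ?] := au i;
      apply/andP; split; lra.
  case=> -[b1 b2] [/= eu ru]; split; first by rewrite mass1E.
  move=> i; have := b1 i; have := b2 i; have := ru i I.
  by rewrite /= !in_itv/= subr_ge0 => -> /andP[-> _] /andP[_ ->].
apply: compact_closedI; first exact: compact_setX.
apply: closedI.
  apply: (proj1 (continuous_closedP _) (@continuous_transport_cost _ _ _)
    [set x | eps <= x]); exact: closed_ge.
apply: closed_bigI => i _.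
have c : continuous (fun u : 'rV[R]_N * 'rV[R]_N => u.1 0 i - u.2 0 i).
  move=> u; apply: cvgB; first exact: continuous_coord1.
  exact: continuous_coord2.
by apply: (proj1 (continuous_closedP _) c [set x | 0 <= x]); exact: closed_ge.
Qed.

Lemma Phi_max k0 kbar d theta eps risk w0 :
  allocations eps (w0, 0) -> transport_cost k0 kbar d (w0, 0) < theta ->
  Phi_values k0 kbar theta eps risk d (Phi k0 kbar theta eps risk d) /\
  ubound (Phi_values k0 kbar theta eps risk d) (Phi k0 kbar theta eps risk d).
Proof.
move=> a0 cost0; rewrite /Phi Phi_valuesE.
set F := _ `&` _; have F0 : F !=set0 by exists (w0, 0); split => //; exact: ltW.
have cF : compact F.
  apply: compact_closedI; first exact: allocations_compact.
  apply: (proj1 (continuous_closedP _) (@continuous_transport_cost k0 kbar d)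
    [set x | x <= theta]); exact: closed_le.
have [c /set_mem Fc cmax] := compact_EVT_max F0 cF
  (continuous_subspaceT (@continuous_excess risk)).
have ub : ubound (excess risk @` F) (excess risk c).
  by move=> _ [u Fu <-]; apply: cmax; rewrite inE.
have -> : sup (excess risk @` F) = excess risk c.
  apply/eqP; rewrite eq_le ge_sup//=; last by exists (excess risk c), c.
  by apply: ub_le_sup; [exists (excess risk c)|exists c].
by split=> //; exists c.
Qed.

Lemma vartheta_min k0 kbar d eps risk w0 : 0 <= risk <= 1 ->
  allocations eps (w0, 0) ->
  vartheta_values k0 kbar eps risk d (vartheta k0 kbar eps risk d) /\
  lbound (vartheta_values k0 kbar eps risk d) (vartheta k0 kbar eps risk d).
Proof.
move=> /andP[risk0 risk1] [mw0 aw0]; rewrite /vartheta /vartheta_values boundary_polytopeE.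
set f := transport_cost _ _ _; set F := _ `&` _.
have F0 : F !=set0.
  exists (w0, risk *: w0); split.
    split=> // i; have [] := aw0 i; rewrite /= !mxE => /andP[_ w0i] ?.
    by split=> //; rewrite mulr_ge0//= ler_piMl.
  rewrite /= /excess /= (_ : risk *: w0 = risk *: w0 + 0 *: w0).
    by rewrite mass_lin; ring.
  by rewrite scale0r addr0.
have cF : compact F.
  apply: compact_closedI; first exact: allocations_compact.
  apply: (proj1 (continuous_closedP _) (@continuous_excess risk)
    [set x | x = 0]); exact: closed_eq.
have [c /set_mem Fc cmin] := compact_EVT_min F0 cF
  (continuous_subspaceT (@continuous_transport_cost k0 kbar d)).
have lb : lbound (f @` F) (f c).
  by move=> _ [u Fu <-]; apply: cmin; rewrite inE.
have -> : inf (f @` F) = f c.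
  apply/eqP; rewrite eq_le lb_le_inf ?andbT//; last by exists (f c), c.
  by apply: ge_inf; [exists (f c)|exists c].
by split=> //; exists c.
Qed.

(** Each implication is proved by contradiction from attained optima: a maximizer
with positive excess would give a boundary point cheaper than [theta], and a
boundary point cheaper than [theta] would give a feasible point with positive
excess. *)
Lemma Phi_le0E k0 kbar d theta eps risk w0 : 0 < eps -> 0 < risk < 1 ->
  allocations eps (w0, 0) -> transport_cost k0 kbar d (w0, 0) < theta ->
  Phi k0 kbar theta eps risk d <= 0 <-> theta <= vartheta k0 kbar eps risk d.
Proof.
move=> eps0 /andP[risk0 risk1] a0 cost0.
have [+ Pub] := Phi_max risk a0 cost0; rewrite {1}Phi_valuesE => -[u [au cu] eu].
have [[v Cv ev] vlb] : _ /\ _ := vartheta_min k0 kbar d (risk := risk) ltac:(by rewrite !ltW) a0.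
split=> [P0|tv].
- rewrite leNgt -ev; apply/negP => cv.
  have [u' [au' cu' eu']] := boundary_to_excess eps0 risk1 Cv cv.
  suff : excess risk u' <= 0 by rewrite leNgt eu'.
  apply: le_trans P0; apply: Pub; rewrite Phi_valuesE; exists u' => //.
  by split=> //; exact: ltW.
- rewrite leNgt; apply/negP => P0.
  have [delta delta0|v' Cv' cv'] := boundary_cost_lt risk0 P0 a0 cost0.
    by exists u; split=> //; apply: le_trans cu _; rewrite lerDl ltW.
  suff : theta <= transport_cost k0 kbar d v' by rewrite leNgt cv'.
  by apply: le_trans tv _; apply: vlb; exists v'.
Qed.

End linear_programs.

(** * Measurability of the ground cost *)

Section metric_measurability.
Context (R : realType) (X : completePMetricType R).

Lemma open_mball (q : X) (r : R) : open [set x | mdist q x < r].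
Proof.
rewrite openE => x /= qx; apply/nbhs_ballP; exists (r - mdist q x) => /=.
  by rewrite subr_gt0.
move=> y; rewrite ballEmdist /= => xy.
by apply: le_lt_trans (metric_triangle q x y) _; lra.
Qed.

Lemma measurable_mball (q : X) (r : R) :
  measurable ([set x | mdist q x < r] : set (borel X)).
Proof. by apply: sub_sigma_algebra; exact: open_mball. Qed.

Lemma measurable_point (q : X) : measurable ([set q] : set (borel X)).
Proof.
have -> : [set q] = \bigcap_n [set x | mdist q x < n.+1%:R^-1].
  apply/seteqP; split => [_ -> n _ /=|x /= qx].
    by rewrite mdistxx invr_gt0.
  apply/esym/mdist_positivity/eqP; rewrite eq_le mdist_ge0 andbT.
  rewrite leNgt; apply/negP => h.
  have [n nx] := ltr_add_invr h.
  by have := qx n I; rewrite /= ltNge (le_trans _ (ltW nx))// add0r.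
by apply: bigcapT_measurable => n; exact: measurable_mball.
Qed.

(** The product of the Borel sigma-algebras could be smaller than the Borel
sigma-algebra of the product, so continuity alone is not enough. Separability
writes each sublevel set of the distance as a countable union of products of
balls, centred on a dense sequence and with rational radii. *)
Lemma measurable_mdist : separable X ->
  measurable_fun setT (fun u : borel X * borel X => mdist (u.1 : X) (u.2 : X)).
Proof.
move=> [A cA dA].
have [A0|[f]] := pfcard_geP cA.
  have [x] : setT `&` A !=set0 by apply: dA; [exists point|exact: openT].
  by rewrite A0 => -[].
have near_dense (x : X) (e : R) : 0 < e -> exists n, mdist (f n) x < e.
  move=> e0; have [y [/= yx Ay]] : [set y | mdist x y < e] `&` A !=set0.
    by apply: dA; [exists x; rewrite /= mdistxx|exact: open_mball].
  have [n _ fn] := @surj _ _ _ _ f _ Ay.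
  by exists n; rewrite fn metric_sym.
apply: (measurability _ (RGenInftyO.measurableE R)) => //.
move=> _ [_ [a ->] <-]; rewrite setTI.
have -> : (fun u : borel X * borel X => mdist (u.1 : X) (u.2 : X)) @^-1` `]-oo, a[ =
    \bigcup_(q : rat) \bigcup_n
      ([set x | mdist (f n) x < ratr q] `*` [set x | mdist (f n) x < a - ratr q]).
  apply/seteqP; split => -[x y] /=; rewrite in_itv/=.
    move=> xya; pose e := a - mdist x y.
    have e0 : 0 < e by rewrite subr_gt0.
    have [n nx] := near_dense x (e / 4) ltac:(lra).
    have /rat_in_itvoo[q /itvP qe] : e / 4 < e / 2 by lra.
    have eq1 : e / 4 < ratr q by rewrite qe.
    have eq2 : ratr q < e / 2 by rewrite qe.
    exists q => //; exists n => //; split => /=; first lra.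
    by have := metric_triangle (f n) x y; rewrite /e in eq2 nx *; lra.
  move=> [q _ [n _ [/= nx ny]]].
  have := metric_triangle x (f n) y; rewrite (metric_sym x (f n)); lra.
apply: bigcupT_measurable_rat => q; apply: bigcupT_measurable => n.
by apply: measurableX; exact: measurable_mball.
Qed.

End metric_measurability.

Lemma measurable_ground_cost (R : realType) (X Y : completePMetricType R) :
  separable X -> separable Y ->
  measurable_fun setT (fun u : (borel X * borel Y) * (borel X * borel Y) =>
    (@ground_cost R X Y u.1 u.2)%:E).
Proof.
move=> sX sY; apply/measurable_EFinP.
have m1 : measurable_fun setT (fun u : (borel X * borel Y) * (borel X * borel Y)
    => mdist (u.1.1 : X) u.2.1).
  apply: (measurableT_comp (measurable_mdist sX)
    (g := fun u : (borel X * borel Y) * (borel X * borel Y) => (u.1.1, u.2.1))).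
  apply: measurable_fun_pair; apply: (measurableT_comp measurable_fst).
    exact: measurable_fst.
  exact: measurable_snd.
have m2 : measurable_fun setT (fun u : (borel X * borel Y) * (borel X * borel Y)
    => mdist (u.1.2 : Y) u.2.2).
  apply: (measurableT_comp (measurable_mdist sY)
    (g := fun u : (borel X * borel Y) * (borel X * borel Y) => (u.1.2, u.2.2))).
  apply: measurable_fun_pair; apply: (measurableT_comp measurable_snd).
    exact: measurable_fst.
  exact: measurable_snd.
exact: measurable_funD m1 m2.
Qed.

(** * Couplings with an empirical measure *)

Lemma integral_step d (T : measurableType d) (R : realType)
    (mu : {measure set T -> \bar R}) (I : Type) (s : seq I) (c : I -> R)
    (E : I -> set T) :
  (forall i, 0 <= c i) -> (forall i, measurable (E i)) ->
  (\int[mu]_x (\sum_(i <- s) c i * \1_(E i) x)%:E =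
   \sum_(i <- s) (c i)%:E * mu (E i))%E.
Proof.
move=> c0 mE; under eq_integral do rewrite -sumEFin.
rewrite ge0_integral_sum//; last 2 first.
- by move=> i; apply/measurable_EFinP; apply: measurable_funM.
- by move=> i x _; rewrite lee_fin mulr_ge0.
apply: eq_bigr => i _; under eq_integral do rewrite EFinM.
rewrite ge0_integralZl ?lee_fin//; last exact/measurable_EFinP.
by rewrite integral_indic// setIT.
Qed.

Section atom_shares.
Context (R : realType) (d : measure_display) (T : measurableType d) (N : nat).
Variable s : 'I_N -> T.

(** Samples may coincide, in which case they form a single atom of the empirical
measure; its mass is divided equally among them. *)
Definition multiplicity (i : 'I_N) : R := #|[pred j | s j == s i]|%:R.

Lemma multiplicity_gt0 i : 0 < multiplicity i.
Proof. by rewrite ltr0n; apply/card_gt0P; exists i; rewrite inE. Qed.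

(** Summing over all the samples equal to [s k], each weighted by the inverse
multiplicity, counts the atom once. *)
Lemma sum_over_atoms (F : 'I_N -> R) (k : 'I_N) (y : R) :
  (forall i, s i = s k -> F i = y) ->
  \sum_i (multiplicity i)^-1 * (F i * (s k \in [set s i])%:R) = y.
Proof.
move=> Fy; rewrite (bigID (fun i => s i == s k))/= [X in _ + X]big1 ?addr0.
  transitivity (\sum_(i | s i == s k) (multiplicity k)^-1 * y).
    apply: eq_bigr => i /eqP ik; rewrite (Fy _ ik) /multiplicity ik.
    by rewrite mem_set//= mulr1.
  rewrite sumr_const -mulr_natl mulrA -/(multiplicity k) divff ?mul1r//.
  by rewrite gt_eqF// multiplicity_gt0.
by move=> i /eqP ik; rewrite memNset ?mulr0//= => /esym.
Qed.
End atom_shares.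

Section coupling_with_empirical.
Context (R : realType) (d : measure_display) (T : measurableType d) (N : nat).
Variables (s : 'I_N -> T) (P : {measure set T -> \bar R}).
Variable (pi : probability (T * T)%type R).
Hypothesis atom_measurable : forall i, measurable [set s i].
Hypothesis pi_coupling : coupling P (empirical R s) pi.

Local Notation mult := (@multiplicity R d T N s).

(** The mass that the coupling [pi] transports into [A] from the part of the atom
[s i] attributed to the [i]-th sample. This replaces a disintegration of [pi]
along its second marginal. *)
Definition share (A : set T) (i : 'I_N) : R :=
  (mult i)^-1 * fine (pi (A `*` [set s i])).

Lemma share_ge0 A i : 0 <= share A i.
Proof.
by rewrite mulr_ge0// ?invr_ge0 ?(ltW (multiplicity_gt0 _ _ _))// fine_ge0.
Qed.

Lemma le_share A B i : measurable A -> measurable B -> A `<=` B ->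
  share A i <= share B i.
Proof.
move=> mA mB AB; rewrite ler_wpM2l ?invr_ge0 ?(ltW (multiplicity_gt0 _ _ _))//.
have mX C : measurable C -> measurable (C `*` [set s i]).
  by move=> mC; exact: measurableX.
apply: fine_le; rewrite ?fin_num_measure//; try exact: mX.
by apply: le_measure; rewrite ?inE; [exact: mX|exact: mX|move=> u [/AB]].
Qed.

Lemma shareT i : share setT i = N%:R^-1.
Proof.
rewrite /share setTX; have [_] := pi_coupling (atom_measurable i).
rewrite /pushforward => ->; rewrite /= /empirical.
have -> : (\sum_(j < N) \d_(s j) [set s i] = (mult i)%:E)%E.
  rewrite /mult -sum1_card natr_sum -sumEFin [RHS]big_mkcond/=.
  apply: eq_bigr => j _; rewrite diracE inE; case: eqP => [->|ji].
    by rewrite mem_set.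
  by rewrite memNset.
by rewrite -EFinM /= mulrCA mulVf ?mulr1// gt_eqF// multiplicity_gt0.
Qed.

Lemma shareU A B i : measurable A -> measurable B -> A `&` B = set0 ->
  share (A `|` B) i = share A i + share B i.
Proof.
move=> mA mB AB; rewrite /share -mulrDr; congr (_ * _).
have mX C : measurable C -> measurable (C `*` [set s i]).
  by move=> mC; exact: measurableX.
have -> : (A `|` B) `*` [set s i] = A `*` [set s i] `|` B `*` [set s i].
  apply/seteqP; split => u.
    by move=> [[?|?] ?]; [left|right].
  by move=> [] [? ?]; split => //; [left|right].
rewrite measureU//; [|exact: mX|exact: mX|].
  by rewrite fineD ?fin_num_measure//; exact: mX.
apply/seteqP; split => // -[x y] [[/= Ax _] [/= Bx _]].
by have : (A `&` B) x by []; rewrite AB.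
Qed.

Let range_s := [set s i | i in [set: 'I_N]].

Let range_measurable : measurable range_s.
Proof.
have -> : range_s = \bigcup_(i in [set: 'I_N]) [set s i].
  by apply/seteqP; split => x; [move=> [i _ <-]; exists i|move=> [i _ ->]; exists i].
by apply: fin_bigcup_measurable => // i _.
Qed.

(** The second marginal of [pi] is carried by the samples, so nothing reaches [A]
from elsewhere. *)
Lemma sum_share A : measurable A -> (\sum_i share A i)%:E = P A.
Proof.
move=> mA; have [PA _] := pi_coupling mA; rewrite -PA /pushforward.
have mA1 : measurable (fst @^-1` A : set (T * T)).
  by rewrite -[_ @^-1` _]setTI; exact: measurable_fst.
have mA2 : measurable (A `*` range_s) by exact: measurableX.
have -> : pi (fst @^-1` A) = pi (A `*` range_s).
  apply/eqP; rewrite eq_le; apply/andP; split; last first.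
    by apply: le_measure; rewrite ?inE// => u [].
  have m2 : measurable (snd @^-1` (~` range_s) : set (T * T)).
    by rewrite -[_ @^-1` _]setTI; apply: measurable_snd => //; exact: measurableC.
  have p0 : pi (snd @^-1` (~` range_s)) = 0%E.
    have [_] := pi_coupling (measurableC range_measurable).
    rewrite /pushforward => ->; rewrite /= /empirical big1 ?mule0// => i _.
    by rewrite diracE memNset//=; apply; exists i.
  rewrite -[leRHS]adde0 -p0.
  apply: le_trans (measureU2 _ _ _) => //.
  apply: le_measure; rewrite ?inE//; first exact: measurableU.
  move=> u /= Au; have [ru|ru] := pselect (range_s u.2); first by left.
  by right.
transitivity (\int[pi]_u (\sum_i (mult i)^-1 * \1_(A `*` [set s i]) u)%:E)%E.
  rewrite integral_step//.
  - rewrite -sumEFin; apply: eq_bigr => i _; rewrite /share EFinM fineK//.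
    by rewrite fin_num_measure//; exact: measurableX.
  - by move=> i; rewrite invr_ge0 (ltW (multiplicity_gt0 _ _ _)).
  - by move=> i; exact: measurableX.
rewrite -[A `*` range_s]setIT -integral_indic//; apply: eq_integral => -[x y] _ /=.
congr EFin; have [[k _ <-]|ry] := pselect (range_s y).
  have -> : \1_(A `*` range_s) (x, s k) = (x \in A)%:R :> R.
    by rewrite indicE; congr (_%:R); rewrite in_setX/= andb_idr// => _; rewrite inE; exists k.
  rewrite -[RHS](@sum_over_atoms R _ _ _ s (fun=> (x \in A)%:R) k)//.
  by apply: eq_bigr => i _; rewrite indicE in_setX /= -natrM mulnb.
rewrite indicE memNset; last by case.
rewrite big1// => i _; rewrite indicE memNset ?mulr0//= => -[_ yi].
by apply: ry; exists i.
Qed.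

(** The integrand is bounded below, on the fibre above each sample, by a step
function; the second coordinate is almost surely a sample, so integrating the
step functions gives the bound. The weights [c k i] may differ between equal
samples, because the bound is averaged over the samples of an atom. *)
Lemma coupling_integral_ge (K : finType) (c : K -> 'I_N -> R) (A : K -> set T)
    (f : T -> T -> R) :
  (forall k i, 0 <= c k i) -> (forall k, measurable (A k)) ->
  (forall x y, 0 <= f x y) ->
  measurable_fun setT (fun u : T * T => (f u.1 u.2)%:E) ->
  (forall i x, \sum_k c k i * \1_(A k) x <= f x (s i)) ->
  ((\sum_k \sum_i c k i * share (A k) i)%:E <= \int[pi]_u (f u.1 u.2)%:E)%E.
Proof.
move=> c0 mA f0 mf cf.
pose E (p : 'I_N * K) := A p.2 `*` [set s p.1].
pose e (p : 'I_N * K) := (mult p.1)^-1 * c p.2 p.1.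
have mE p : measurable (E p) by exact: measurableX.
have e0 p : 0 <= e p.
  by rewrite mulr_ge0// invr_ge0 (ltW (multiplicity_gt0 _ _ _)).
have -> : ((\sum_k \sum_i c k i * share (A k) i)%:E =
           \int[pi]_u (\sum_p e p * \1_(E p) u)%:E)%E.
  rewrite integral_step// exchange_big pair_bigA/= -sumEFin.
  apply: eq_bigr => p _; rewrite /e /share.
  rewrite mulrCA mulrA EFinM fineK// fin_num_measure//; exact: mE.
apply: ge0_le_integral => //.
- by move=> u _; rewrite lee_fin sumr_ge0// => p _; rewrite mulr_ge0.
- apply/measurable_EFinP; apply: measurable_sum => p.
  exact: measurable_funM.
move=> [x y] _ /=; rewrite lee_fin -(pair_bigA _ (fun i k => e (i, k) * \1_(E (i, k)) (x, y)))/=.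
have [[k _ <-]|ry] := pselect (range_s y).
  rewrite -(@sum_over_atoms R _ _ _ s (fun i => f x (s i)) k (f x (s k))); last first.
    by move=> i ->.
  apply: ler_sum => i _.
  have -> : \sum_l e (i, l) * \1_(E (i, l)) (x, s k) =
      (mult i)^-1 * ((\sum_l c l i * \1_(A l) x) * (s k \in [set s i])%:R).
    rewrite mulr_suml mulr_sumr; apply: eq_bigr => l _.
    by rewrite /e /E /= !indicE in_setX /= -mulnb natrM; ring.
  by rewrite ler_wpM2l ?invr_ge0 ?(ltW (multiplicity_gt0 _ _ _))// ler_wpM2r.
rewrite big1 // => i _; rewrite big1// => k _.
rewrite indicE memNset ?mulr0//= => -[_ yi].
by apply: ry; exists i.
Qed.

End coupling_with_empirical.

(** * Discrete probabilities *)

(** Repeated points are allowed, which is why the measure is described by a weighted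
family and not by a function on its support. *)
Lemma discrete_measure (R : realType) d (T : measurableType d) (I : Type)
    (s : seq I) (c : I -> R) (p : I -> T) : (forall i, 0 <= c i) ->
  exists mu : {measure set T -> \bar R},
    (forall A, mu A = \sum_(i <- s) (c i)%:E * \d_(p i) A)%E /\
    (forall f : T -> R, measurable_fun setT (fun x => (f x)%:E) ->
       (forall x, (0 <= f x)%R) ->
       \int[mu]_x (f x)%:E = (\sum_(i <- s) c i * f (p i))%R%:E)%E.
Proof.
move=> c0; elim: s => [|i s [mu [muA muf]]].
  exists mzero; split=> [A|f mf f0]; first by rewrite big_nil.
  by rewrite big_nil integral_measure_zero.
exists (measure_add (mscale (NngNum (c0 i)) \d_(p i)) mu); split=> [A|f mf f0].
  by rewrite -[LHS]/(measure_add _ _ _) measure_addE big_cons muA.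
rewrite ge0_integral_measure_add//; last by move=> x _; rewrite lee_fin.
rewrite ge0_integral_mscale//; last by move=> x _; rewrite lee_fin.
by rewrite integral_dirac// diracT mul1e big_cons muf// EFinD EFinM.
Qed.

Definition as_probability (R : realType) d (T : measurableType d)
  (mu : {measure set T -> \bar R}) (mu1 : mu setT = 1%E) : set T -> \bar R := mu.

HB.instance Definition _ (R : realType) d (T : measurableType d)
    (mu : {measure set T -> \bar R}) (mu1 : mu setT = 1%E) :=
  Measure.on (as_probability mu1).

HB.instance Definition _ (R : realType) d (T : measurableType d)
    (mu : {measure set T -> \bar R}) (mu1 : mu setT = 1%E) :=
  Measure_isProbability.Build d T R (as_probability mu1) mu1.

Lemma discrete_probability (R : realType) d (T : measurableType d)
    (I : finType) (c : I -> R) (p : I -> T) :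
  (forall i, 0 <= c i) -> \sum_i c i = 1 ->
  exists P : probability T R,
    (forall A, P A = (\sum_i c i * (p i \in A)%:R)%:E)%E /\
    (forall f : T -> R, measurable_fun setT (fun x => (f x)%:E) ->
       (forall x, (0 <= f x)%R) ->
       \int[P]_x (f x)%:E = (\sum_i c i * f (p i))%R%:E)%E.
Proof.
move=> c0 c1.
have [mu [muA muf]] := discrete_measure (index_enum I) p c0.
have muE A : mu A = (\sum_i c i * (p i \in A)%:R)%:E.
  by rewrite muA -sumEFin; apply: eq_bigr => i _; rewrite diracE EFinM.
have mu1 : mu setT = 1%E.
  rewrite muE -[in RHS]c1; congr EFin; apply: eq_bigr => i _; by rewrite in_setT mulr1.
by exists (as_probability mu1).
Qed.

(** * Mass allocations and couplings *)

Section set_distance.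
Context (R : realType) (T : completePMetricType R).
Implicit Types (a x : T) (A : set T).

Lemma set_dist_ge0 a A : (0 <= set_dist a A)%E.
Proof. by apply: le_ereal_inf_tmp => _ [x _ <-]; rewrite lee_fin mdist_ge0. Qed.

Lemma fine_set_dist_ge0 a A : 0 <= fine (set_dist a A).
Proof. by rewrite fine_ge0// set_dist_ge0. Qed.

Lemma fine_set_dist_le a A x : A x -> fine (set_dist a A) <= mdist x a.
Proof.
move=> Ax; rewrite metric_sym -lee_fin.
have le : (set_dist a A <= (mdist a x)%:E)%E by apply: ereal_inf_lbound; exists x.
rewrite fineK// ge0_fin_numE ?set_dist_ge0//; exact: le_lt_trans le (ltry _).
Qed.

Lemma near_set_dist a A (delta : R) : (set_dist a A < +oo)%E -> 0 < delta ->
  exists2 x, A x & mdist x a < fine (set_dist a A) + delta.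
Proof.
move=> Afin d0.
have : (set_dist a A < (fine (set_dist a A) + delta)%:E)%E.
  by rewrite EFinD fineK ?lteDl ?ge0_fin_numE ?set_dist_ge0// ?lte_fin//;
    rewrite ge0_fin_numE ?set_dist_ge0.
move=> /ereal_inf_lt[_ [x Ax <-]]; rewrite lte_fin => ax.
by exists x => //; rewrite metric_sym.
Qed.

End set_distance.

Section transport.
Context (R : realType) (X Y : completePMetricType R).
Hypotheses (sepX : separable X) (sepY : separable Y).
Context (N : nat) (xhat : 'I_N -> X) (yhat : 'I_N -> Y) (calN : set X).
Hypothesis calN_borel : measurable (calN : set (borel X)).

Local Notation sample := (fun i => (xhat i, yhat i) : borel X * borel Y).
Local Notation k0 := (K0 xhat calN).
Local Notation kbar := (kappa_bar xhat calN).
Local Notation inN := (fst @^-1` calN : set (borel X * borel Y)).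
Local Notation cost u := (@ground_cost R X Y u.1 u.2).

Lemma ground_cost_ge0 (p q : X * Y) : 0 <= ground_cost p q.
Proof. by rewrite addr_ge0// mdist_ge0. Qed.

(** From any coupling one reads off the mass [w i] that the [i]-th sample sends over
the neighbourhood and the part [r i] of it that lands in the unsafe set. A unit of
mass pays at least the distance from the sample to the region where it ends,
which sums up to the linear transport cost. *)
Lemma coupling_allocation (eps : R) (safe : set Y)
    (P : probability (borel X * borel Y)%type R) pi :
  measurable (~` safe : set (borel Y)) ->
  coupling P (empirical R sample) pi -> (eps%:E <= P inN)%E ->
  exists u, [/\ allocations eps u,
    ((transport_cost k0 kbar (Delta yhat safe) u)%:E <=
       \int[pi]_v (cost v)%:E)%E,
    (mass u.1)%:E = P inN &
    (mass u.2)%:E = P (snd @^-1` (~` safe) `&` inN)].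
Proof.
move=> mU cpi epsP.
have mT : measurable (setT : set (borel Y)) by [].
pose AN : set (borel X * borel Y) := calN `*` setT.
pose AU : set (borel X * borel Y) := calN `*` ~` safe.
pose AC : set (borel X * borel Y) := ~` calN `*` setT.
have mAN : measurable AN by exact: measurableX.
have mAU : measurable AU by exact: measurableX.
have mAC : measurable AC by apply: measurableX => //; exact: measurableC.
have ANE : AN = inN by apply/seteqP; split => [u []//|u].
have AUE : AU = snd @^-1` (~` safe) `&` inN.
  by apply/seteqP; split => u [? ?].
have matom i : measurable [set sample i].
  have -> : [set sample i] = [set (xhat i : borel X)] `*` [set (yhat i : borel Y)].
    by apply/seteqP; split => [_ -> //|[x y] [/= -> ->]].
  by apply: measurableX; exact: measurable_point.
pose w := \row_i share sample pi AN i : 'rV[R]_N.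
pose r := \row_i share sample pi AU i : 'rV[R]_N.
have mw : (mass w)%:E = P inN.
  by rewrite -ANE -(sum_share matom cpi mAN) /mass; under eq_bigr do rewrite mxE.
have mr : (mass r)%:E = P (snd @^-1` (~` safe) `&` inN).
  by rewrite -AUE -(sum_share matom cpi mAU) /mass; under eq_bigr do rewrite mxE.
exists (w, r); split=> //=.
  split=> [|i]; first by rewrite -lee_fin mw.
  rewrite !mxE share_ge0 -(shareT matom cpi i) !le_share//.
  by move=> u [].
(* Three prices: leaving the neighbourhood, entering it, and the surcharge for
   ending in the unsafe set. *)
pose c (k : 'I_3) i := match val k with
  | 0 => fine (set_dist (xhat i) (~` calN))
  | 1 => fine (set_dist (xhat i) calN)
  | _ => fine (set_dist (yhat i) (~` safe)) end.
pose A (k : 'I_3) := match val k with 0 => AC | 1 => AN | _ => AU end.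
have -> : transport_cost k0 kbar (Delta yhat safe) (w, r) =
    \sum_k \sum_i c k i * share sample pi (A k) i.
  rewrite !big_ord_recl big_ord0 addr0 /= addrA; congr (_ + _).
    rewrite /K0 /dotv mulr_sumr -!big_split/=; apply: eq_bigr => i _.
    rewrite !mxE /c /A /=.
    have -> : share sample pi AC i = N%:R^-1 - share sample pi AN i.
      rewrite -(shareT matom cpi i).
      rewrite (_ : [set: borel X * borel Y] = AC `|` AN).
        rewrite (shareU pi matom i mAC mAN); first by rewrite addrK.
        by rewrite -subset0 => u [[? _] [? _]].
      apply/seteqP; split => // u _.
      by have [?|?] := pselect (calN u.1); [right|left].
    ring.
  by rewrite /dotv; apply: eq_bigr => i _; rewrite !mxE.
have c0 k i : 0 <= c k i.
  by rewrite /c; case: k => [[|[|k]] ?] /=; exact: fine_set_dist_ge0.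
have mA k : measurable (A k) by case: k => [[|[|k]] ?].

apply: (coupling_integral_ge pi matom c0 mA ground_cost_ge0 (measurable_ground_cost sepX sepY)).
move=> i [x y]; rewrite !big_ord_recl big_ord0 addr0 /c /A /= !indicE /ground_cost/=.
have [xN|xN] := pselect (calN x).
  rewrite [_ \in AC]memNset; last by case.
  rewrite [_ \in AN]mem_set// mulr0 mulr1 add0r.
  apply: lerD; first exact: fine_set_dist_le.
  have [yU|yU] := pselect ((~` safe) y).
    by rewrite mem_set// mulr1; exact: fine_set_dist_le.
  by rewrite memNset ?mulr0 ?mdist_ge0// => -[].
rewrite [_ \in AC]mem_set// [_ \in AN]memNset; last by case.
rewrite [_ \in AU]memNset; last by case.
rewrite !mulr0 !addr0 mulr1; apply: ler_wpDr; first exact: mdist_ge0.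
exact: fine_set_dist_le.
Qed.

(** Conversely an allocation is realized, up to an arbitrarily small extra cost, by
cutting each sample into three pieces sent to nearly closest points: [r i] into
the neighbourhood with an unsafe outcome, [w i - r i] into the neighbourhood with
the outcome kept, and the rest outside the neighbourhood. The distances need not
be attained, hence the strict budget. A kept outcome may itself be unsafe, hence
only an inequality for the unsafe mass. *)
Lemma allocation_coupling (eps theta : R) (safe : set Y) u : (0 < N)%N ->
  (forall i, (set_dist (xhat i) calN < +oo)%E) ->
  (forall i, (set_dist (xhat i) (~` calN) < +oo)%E) ->
  (forall i, (set_dist (yhat i) (~` safe) < +oo)%E) ->
  allocations eps u -> transport_cost k0 kbar (Delta yhat safe) u < theta ->
  exists P : probability (borel X * borel Y)%type R,
    [/\ (wasserstein P (empirical R sample) <= theta%:E)%E,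
        P inN = (mass u.1)%:E &
        ((mass u.2)%:E <= P (snd @^-1` (~` safe) `&` inN))%E].
Proof.
case: u => w r N0 din dout dU [_ /= au] cu.
have Npos : 0 < N%:R :> R by rewrite ltr0n.
pose delta := (theta - transport_cost k0 kbar (Delta yhat safe) (w, r)) / 2.
have delta0 : 0 < delta by rewrite divr_gt0// subr_gt0.
have /choice[xin xinP] : forall i, exists x, calN x /\
    mdist x (xhat i) < fine (set_dist (xhat i) calN) + delta.
  by move=> i; have [x ? ?] := near_set_dist (din i) delta0; exists x.
have /choice[xout xoutP] : forall i, exists x, (~` calN) x /\
    mdist x (xhat i) < fine (set_dist (xhat i) (~` calN)) + delta.
  by move=> i; have [x ? ?] := near_set_dist (dout i) delta0; exists x.
have /choice[ybad ybadP] : forall i, exists y, (~` safe) y /\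
    mdist y (yhat i) < fine (set_dist (yhat i) (~` safe)) + delta.
  by move=> i; have [x ? ?] := near_set_dist (dU i) delta0; exists x.
pose I := ('I_N + ('I_N + 'I_N))%type.
pose c (k : I) : R := match k with
  | inl i => r 0 i | inr (inl i) => w 0 i - r 0 i
  | inr (inr i) => N%:R^-1 - w 0 i end.
pose p (k : I) : borel X * borel Y := match k with
  | inl i => (xin i, ybad i) | inr (inl i) => (xin i, yhat i)
  | inr (inr i) => (xout i, yhat i) end.
pose q (k : I) : borel X * borel Y := match k with
  | inl i | inr (inl i) | inr (inr i) => sample i end.
have sumI (F : I -> R) : \sum_k F k =
    \sum_i (F (inl i) + F (inr (inl i)) + F (inr (inr i))).
  by rewrite !big_sumType /= !big_split /= addrA.
have c0 k : 0 <= c k.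
  by case: k => [i|[i|i]] /=; have [/andP[? ?] ?] := au i; rewrite ?subr_ge0.
have c1 : \sum_k c k = 1.
  rewrite sumI; transitivity (\sum_(i < N) (N%:R^-1 : R)).
    by apply: eq_bigr => i _ /=; ring.
  by rewrite sumr_const card_ord -(mulr_natl _^-1) divff// gt_eqF.
have [P [PA _]] := discrete_probability p c0 c1.
have [pi [piA piint]] := discrete_probability (fun k => (p k, q k)) c0 c1.
exists P; split.
- apply: (@le_trans _ _ (\int[pi]_v (cost v)%:E)%E).
    apply: ereal_inf_lbound; exists pi => // A mA; split.
      by rewrite /pushforward piA [RHS]PA.
    rewrite /pushforward piA /= /empirical.
    have -> : (\sum_(i < N) \d_(sample i) A)%E =
        (\sum_(i < N) (sample i \in A)%:R)%:E :> \bar R.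
      by rewrite -sumEFin; apply: eq_bigr => i _; rewrite diracE.
    rewrite -EFinM; congr EFin; rewrite sumI mulr_sumr.
    apply: eq_bigr => i _ /=; rewrite -!mulrDl; congr (_ * _); ring.
  rewrite piint; last 2 first.
  + exact: measurable_ground_cost.
  + by move=> v; exact: ground_cost_ge0.
  rewrite lee_fin sumI /=.
  apply: (@le_trans _ _ (\sum_i (N%:R^-1 * fine (set_dist (xhat i) (~` calN)) +
      kbar 0 i * w 0 i + Delta yhat safe 0 i * r 0 i + N%:R^-1 * (2 * delta)))).
    apply: ler_sum => i _; rewrite /ground_cost /= mdistxx !addr0 !mxE.
    have [_ /ltW hin] := xinP i; have [_ /ltW hout] := xoutP i.
    (* Each point is within delta of optimal; since w i and r i are at most 1/N,
       the extra cost of sample i is at most 2 delta / N. *)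
    have [_ /ltW hbad] := ybadP i; have [/andP[r0 rw] wN] := au i.
    move: hin hout hbad r0 rw wN delta0; rewrite /= => *; nra.
  rewrite !big_split /= -mulr_sumr sumr_const card_ord -(mulr_natl (_ * _)).
  rewrite (_ : N%:R * _ = 2 * delta); last by rewrite mulrA divff ?mul1r// gt_eqF.
  rewrite /delta (_ : \sum_i fine _ = \sum_i kappa_out xhat calN 0 i); last first.
    by apply: eq_bigr => i _; rewrite mxE.
  by rewrite /transport_cost /K0 /dotv /=; lra.
- rewrite PA; congr EFin; rewrite sumI; apply: eq_bigr => i _ /=.
  rewrite [(xin i, ybad i) \in _]mem_set; last exact: (xinP i).1.
  rewrite [(xin i, yhat i) \in _]mem_set; last exact: (xinP i).1.
  rewrite memNset; last exact: (xoutP i).1.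
  by rewrite !mulr1 mulr0 addr0 addrC subrK.
- rewrite PA lee_fin sumI; apply: ler_sum => i _.
  rewrite [X in c (inl i) * X](_ : _ = 1) /=; last first.
    by rewrite mem_set//; split; [exact: (ybadP i).1|exact: (xinP i).1].
  have [/andP[? ?] ?] := au i.
  by rewrite mulr1 -addrA lerDl addr_ge0// mulr_ge0// subr_ge0.
Qed.

End transport.

(** * The robust chance constraint *)

Section robust_constraint.
Context (R : realType) (X Y : completePMetricType R).
Hypotheses (sepX : separable X) (sepY : separable Y).
Context (N : nat) (xhat : 'I_N -> X) (yhat : 'I_N -> Y) (calN : set X).
Hypothesis calN_borel : measurable (calN : set (borel X)).
Context (eps theta risk : R).
Hypotheses (eps_gt0 : 0 < eps) (risk_itv : 0 < risk < 1).

Local Notation sample := (fun i => (xhat i, yhat i) : borel X * borel Y).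
Local Notation k0 := (K0 xhat calN).
Local Notation kbar := (kappa_bar xhat calN).

(** Discarding the surcharge for unsafe outcomes only lowers the cost, so a single
coupling witnessing [theta_min < theta] provides a strictly feasible allocation
for every price vector at once. *)
Lemma slater_allocation : (theta_min sample calN eps < theta%:E)%E ->
  exists w0, allocations eps (w0, 0) /\
    forall d, transport_cost k0 kbar d (w0, 0) < theta.
Proof.
move=> /ereal_inf_lt[_ [P epsP <-]] /ereal_inf_lt[_ [pi cpi <-]] costpi.
(* Any safety set would do here: the surcharge is dropped below. *)
have mU : measurable (~` setT : set (borel Y)) by rewrite setCT.
have [[w r] [[mw aw] cost_wr _ _]] :=
  coupling_allocation sepX sepY calN_borel mU cpi epsP.
exists w; split.
  split=> // i; have [/andP[r0 rw] wN] := aw i.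
  by rewrite mxE lexx (le_trans r0).
move=> d; rewrite -lte_fin; apply: le_lt_trans costpi.
apply: le_trans cost_wr; rewrite lee_fin /transport_cost /= lerD2l.
rewrite [dotv d 0]big1; last by move=> i _; rewrite mxE mulr0.
apply: sumr_ge0 => i _; have [/andP[r0 _] _] := aw i.
by rewrite mulr_ge0// mxE fine_set_dist_ge0.
Qed.

Lemma cond_prob_leE (P : probability (borel X * borel Y)%type R)
    (A B : set (borel X * borel Y)) : 0 < fine (P B) ->
  (cond_prob P A B <= risk) = (fine (P (A `&` B)) - risk * fine (P B) <= 0).
Proof. by move=> b0; rewrite /cond_prob ler_pdivrMr// subr_le0. Qed.

(** A boundary allocation cheaper than [theta] is perturbed to positive excess and
realized by a distribution in the ambiguity set, which violates the chance
constraint. A violating distribution has near-optimal couplings, whose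
allocations all have the same positive excess; mixing with the Slater allocation
produces a boundary allocation cheaper than [theta]. *)
Lemma robust_cond_chanceP (safe : set Y) : (0 < N)%N ->
  (forall i, (set_dist (xhat i) calN < +oo)%E) ->
  (forall i, (set_dist (xhat i) (~` calN) < +oo)%E) ->
  (forall i, (set_dist (yhat i) (~` safe) < +oo)%E) ->
  measurable (~` safe : set (borel Y)) ->
  (theta_min sample calN eps < theta%:E)%E ->
  robust_cond_chance sample calN eps theta risk safe <->
  theta <= vartheta k0 kbar eps risk (Delta yhat safe).
Proof.
move=> N_gt0 din dout dU mU theta_gt.
have [w0 [a0 /(_ (Delta yhat safe)) cost0]] := slater_allocation theta_gt.
have /andP[risk0 risk1] := risk_itv.
have [[v Cv ev] vlb] : _ /\ _ := vartheta_min k0 kbar (Delta yhat safe)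
  (risk := risk) ltac:(by rewrite !ltW) a0.
split=> [rob|le_theta].
- rewrite leNgt -ev; apply/negP => cv.
  have [u [au cu eu]] := boundary_to_excess eps_gt0 risk1 Cv cv.
  have [P [WP PN PU]] := allocation_coupling sepX sepY N_gt0 din dout dU au cu.
  have mu0 : 0 < mass u.1 by case: au => /(lt_le_trans eps_gt0).
  have : cond_prob P (snd @^-1` (~` safe)) (fst @^-1` calN) <= risk.
    rewrite -lee_fin; apply: le_trans rob; apply: ereal_sup_ubound; exists P => //.
    by split=> //; rewrite /pushforward [leRHS]PN lee_fin; case: au.
  have fPN : fine (P (fst @^-1` calN)) = mass u.1 by rewrite [X in fine X]PN.
  rewrite cond_prob_leE ?fPN// leNgt => /negP; apply.
  apply: lt_le_trans eu _; rewrite /excess lerD2r -lee_fin fineK//.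
  by rewrite fin_num_measure//; apply: measurableI; rewrite -[_ @^-1` _]setTI;
    [exact: measurable_snd|exact: measurable_fst].
- apply: ge_ereal_sup => _ [P [WP epsP] <-]; rewrite lee_fin.
  rewrite leNgt; apply/negP => bad.
  pose c := fine (P (snd @^-1` (~` safe) `&` fst @^-1` calN)) -
    risk * fine (P (fst @^-1` calN)).
  have c0 : 0 < c.
    rewrite ltNge -cond_prob_leE ?leNgt ?bad//.
    by apply: lt_le_trans eps_gt0 _; rewrite -lee_fin fineK// fin_num_measure//;
      rewrite -[_ @^-1` _]setTI; exact: measurable_fst.
  have [delta delta0|v' Cv' cv'] := boundary_cost_lt risk0 c0 a0 cost0.
    have : (wasserstein P (empirical R sample) < (theta + delta)%:E)%E.
      by apply: le_lt_trans WP _; rewrite lte_fin ltrDl.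
    move=> /ereal_inf_lt[_ [pi cpi <-]] costpi.
    have [u [au cu mw mr]] := coupling_allocation sepX sepY calN_borel mU cpi epsP.
    exists u; split=> //.
      by rewrite -lee_fin; apply: le_trans cu (ltW costpi).
    by rewrite /c -mw -mr.
  suff : theta <= transport_cost k0 kbar (Delta yhat safe) v' by rewrite leNgt cv'.
  by apply: le_trans le_theta _; apply: vlb; exists v'.
Qed.

End robust_constraint.

Theorem theorem4 (R : realType) (X Y : completePMetricType R)
  (sepX : separable X) (sepY : separable Y)
  (N : nat) (N_gt0 : (0 < N)%N)
  (xhat : 'I_N -> X) (yhat : 'I_N -> Y)
  (x0 : X) (gamma : R) (gamma_ge0 : 0 <= gamma)
  (calN : set X)
  (calN_x0 : calN x0)
  (calN_radius : (ereal_sup [set (mdist x x0)%:E | x in calN] <= gamma%:E)%E)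
  (calN_0 : gamma = 0 -> calN = [set x0])
  (calN_borel : measurable (calN : set (borel X)))
  (calN_dist : forall i, (set_dist (xhat i) calN < +oo)%E)
  (calNC_dist : forall i, (set_dist (xhat i) (~` calN) < +oo)%E)
  (dimz : nat) (Z : set 'rV[R]_dimz) (safe : 'rV[R]_dimz -> set Y)
  (unsafe_borel : forall z, Z z -> measurable (~` safe z : set (borel Y)))
  (unsafe_neq0 : forall z, Z z -> ~` safe z !=set0)
  (unsafe_dist : forall z, Z z ->
     forall i, (set_dist (yhat i) (~` safe z) < +oo)%E)
  (eps risk theta : R)
  (eps_itv : 0 < eps <= 1) (risk_itv : 0 < risk < 1) (theta_gt0 : 0 < theta) :
  let sample := fun i => (xhat i, yhat i) : borel X * borel Y in
  let k0 := K0 xhat calN in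
  let kbar := kappa_bar xhat calN in
  (theta_min sample calN eps < theta%:E)%E ->
  (forall d : 'rV[R]_N, (forall i, 0 <= d 0 i) ->
     [/\ Phi_values k0 kbar theta eps risk d
           (Phi k0 kbar theta eps risk d),
         ubound (Phi_values k0 kbar theta eps risk d)
           (Phi k0 kbar theta eps risk d),
         vartheta_values k0 kbar eps risk d (vartheta k0 kbar eps risk d),
         lbound (vartheta_values k0 kbar eps risk d)
           (vartheta k0 kbar eps risk d) &
         Phi k0 kbar theta eps risk d <= 0 <->
           theta <= vartheta k0 kbar eps risk d]) /\
  (forall z, Z z ->
     (robust_cond_chance sample calN eps theta risk (safe z) <->
        theta <= vartheta k0 kbar eps risk (Delta yhat (safe z)))).

Proof.
move=> sample k0 kbar theta_gt.
have /andP[eps0 _] := eps_itv; have /andP[risk0 risk1] := risk_itv.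
have [w0 [a0 cost0]] := slater_allocation sepX sepY calN_borel theta_gt.
split=> [d d0|z Zz]; last first.
  apply: robust_cond_chanceP => //; [exact: unsafe_dist|exact: unsafe_borel].
have [Pmax Pub] := Phi_max risk a0 (cost0 d).
have [vmin vlb] : _ /\ _ := vartheta_min k0 kbar d (risk := risk)
  ltac:(by rewrite !ltW) a0.
by split=> //; exact: Phi_le0E a0 (cost0 d).
Qed.
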